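(* Let $\mathfrak{L}$ be a left Leibniz algebra over a field $\mathbb{F}$, and let $M$ and $N$ be $\mathfrak{L}$-bimodules. Then the truncated tensor products $M\,\overline{\otimes}\,N$ and $M\,\underline{\otimes}\,N$ are $\mathfrak{L}$-bimodules.
   Context: A left Leibniz algebra is an $\mathbb{F}$-vector space $\mathfrak{L}$ with a bilinear multiplication satisfying $x(yz)=(xy)z+y(xz)$. An $\mathfrak{L}$-bimodule is an $\mathbb{F}$-vector space $M$ with bilinear left and right $\mathfrak{L}$-actions satisfying, for all $x,y\in\mathfrak{L}$, $m\in M$: (LLM) $(xy)\cdot m=x\cdot(y\cdot m)-y\cdot(x\cdot m)$; (LML) $(x\cdot m)\cdot y=x\cdot(m\cdot y)-m\cdot(xy)$; (MLL) $(m\cdot x)\cdot y=m\cdot(xy)-x\cdot(m\cdot y)$. For $\mathfrak{L}$-bimodules $M,N$, the space $M\otimes N$ (over $\mathbb{F}$) carries the actions $x\cdot(m\otimes n):=(x\cdot m)\otimes n+m\otimes(x\cdot n)$ and $(m\otimes n)\cdot x:=(m\cdot x)\otimes n+m\otimes(n\cdot x)$. Let $T(M,N)$ be the smallest subspace of $M\otimes N$ that is closed under these left and right actions and contains $$S(M,N):=\{(x\cdot m+m\cdot x)\otimes(n\cdot y)+(m\cdot y)\otimes(x\cdot n+n\cdot x)\mid x,y\in\mathfrak{L},\ m\in M,\ n\in N\}.$$ Put $M_0:=\langle x\cdot m+m\cdot x\mid x\in\mathfrak{L},m\in M\rangle_{\mathbb{F}}$, $M\mathfrak{L}:=\langle m\cdot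 x\mid m\in M,x\in\mathfrak{L}\rangle_{\mathbb{F}}$ (similarly for $N$), and $T_0(M,N):=M_0\otimes N\mathfrak{L}+M\mathfrak{L}\otimes N_0\subseteq M\otimes N$, which is also closed under both actions. Define $$M\,\overline{\otimes}\,N:=(M\otimes N)/T(M,N),\qquad M\,\underline{\otimes}\,N:=(M\otimes N)/T_0(M,N),$$ with the induced left and right actions. *)

(* Defs.v *)
From HB Require Import structures.
From mathcomp Require Import all_boot all_algebra.
From mathcomp Require Import boolp classical_sets.
From mathcomp Require Import freeg.

Set Implicit Arguments.
Unset Strict Implicit.
Unset Printing Implicit Defensive.

Import GRing.Theory.
Local Open Scope classical_set_scope.
Local Open Scope ring_scope.
Local Open Scope quotient_scope.

Reserved Notation "x ∙ y" (at level 40, left associativity).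
Reserved Notation "x *> m" (at level 40, left associativity).
Reserved Notation "m <* x" (at level 40, left associativity).
Reserved Notation "m ⊗ n" (at level 40, left associativity).

Notation bilinear_map f := (bilinear_for *:%R *:%R f).

Definition left_leibniz_axioms (F : fieldType) (L : lmodType F)
    (mul : L -> L -> L) : Prop :=
  bilinear_map mul /\
  forall x y z, mul x (mul y z) = mul (mul x y) z + mul y (mul x z).

HB.mixin Record Lmodule_isLeftLeibniz (F : fieldType) L
    of GRing.Lmodule F L := {
  leib_mul : L -> L -> L;
  left_leibnizP : left_leibniz_axioms leib_mul
}.

#[short(type="leftLeibnizType")]
HB.structure Definition LeftLeibniz (F : fieldType) :=
  {L of GRing.Lmodule F L & Lmodule_isLeftLeibniz F L}.

Notation "x ∙ y" := (leib_mul x y) : ring_scope.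

Definition leibniz_bimodule_axioms (F : fieldType) (L : leftLeibnizType F)
    (M : lmodType F) (l : L -> M -> M) (r : M -> L -> M) : Prop :=
  [/\ bilinear_map l, bilinear_map r,
      (* LLM *) forall x y m, l (x ∙ y) m = l x (l y m) - l y (l x m),
      (* LML *) forall x y m, r (l x m) y = l x (r m y) - r m (x ∙ y) &
      (* MLL *) forall x y m, r (r m x) y = r m (x ∙ y) - l x (r m y)].

HB.mixin Record Lmodule_isLeibnizBimodule (F : fieldType)
    (L : leftLeibnizType F) M of GRing.Lmodule F M := {
  lact : L -> M -> M;
  ract : M -> L -> M;
  leibniz_bimoduleP : leibniz_bimodule_axioms lact ract
}.

#[short(type="leibnizBimodType")]
HB.structure Definition LeibnizBimod (F : fieldType) (L : leftLeibnizType F) :=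
  {M of GRing.Lmodule F M & Lmodule_isLeibnizBimodule F L M}.

Notation "x *> m" := (lact x m) : ring_scope.
Notation "m <* x" := (ract m x) : ring_scope.

Section Subspaces.
Variables (F : fieldType) (V : lmodType F).
Implicit Types (G W : set V) (f : V -> V).

Definition subspace W : Prop := submod_closed (in_set W).

Definition span G : set V := smallest subspace G.

Definition stable f W : Prop := forall v, W v -> W (f v).

Lemma subspaceP W :
  subspace W <-> W 0 /\ forall a u v, W u -> W v -> W (a *: u + v).
Proof.
have inW v : (v \in in_set W) = `[< W v >] by [].
split=> -[W0 WL]; split.
- by move: W0; rewrite inW => /asboolP.
- move=> a u v Wu Wv; apply/asboolP; rewrite -inW.
  by apply: WL; rewrite inW; apply/asboolP.
- by rewrite inW; apply/asboolP.
- by move=> a u v; rewrite !inW => /asboolP Wu /asboolP Wv; apply/asboolP/WL.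
Qed.

Lemma smallest_subspace (C : set V -> Prop) G :
  (forall W, C W -> subspace W) -> subspace (smallest C G).
Proof.
move=> CW; apply/subspaceP; split=> [W [/CW/subspaceP[W0 _] _] //|].
move=> a u v Gu Gv W CGW; have /CW/subspaceP[_ WL] := CGW.1.
by apply: WL; [apply: Gu | apply: Gv].
Qed.

Lemma span_subspace G : subspace (span G).
Proof. exact: smallest_subspace. Qed.

Lemma span_sub G W : subspace W -> G `<=` W -> span G `<=` W.
Proof. exact: smallest_sub. Qed.

Lemma sub_span G : G `<=` span G.
Proof. exact: sub_gen_smallest. Qed.

End Subspaces.

(* The quotient V / W, with canonical projection \pi_(quotmod W). *)
Section QuotientSpace.
Variables (F : fieldType) (V : lmodType F) (W : submodClosed V).

Definition quotmod_ker : {pred V} := [pred v | v \in W].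

Fact quotmod_ker_zmod_closed : zmod_closed quotmod_ker.
Proof. exact: (GRing.submod_closedB (submodClosedP W)). Qed.

HB.instance Definition _ :=
  GRing.isZmodClosed.Build V quotmod_ker quotmod_ker_zmod_closed.

Definition quotmod : Type := Quotient.quot quotmod_ker.

HB.instance Definition _ := EqQuotient.on quotmod.
HB.instance Definition _ := GRing.Zmodule.on quotmod.

(* The map induced by f : V -> V on V / W. It does not depend on the choice  *)
(* of representatives when f is linear and maps W to W: see [quotmod_mapE].  *)
Definition quotmod_map (f : V -> V) (q : quotmod) : quotmod :=
  \pi_quotmod (f (repr q)).

Definition quotmod_scale (a : F) : quotmod -> quotmod := quotmod_map ( *:%R a).

Lemma eq_quotmod (u v : V) :
  (\pi_quotmod u = \pi_quotmod v) <-> (u - v \in W).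
Proof. by rewrite (Quotient.idealrBE quotmod_ker); split=> /eqP. Qed.

Lemma quotmod_mapE (f : V -> V) (v : V) :
  linear f -> {homo f : w / w \in W} ->
  quotmod_map f (\pi v) = \pi_quotmod (f v).
Proof.
move=> fL fW; apply/eq_quotmod.
have fB u w : f (u - w) = f u - f w.
  by rewrite addrC -scaleN1r fL scaleN1r addrC.
by rewrite -fB; apply: fW; apply/eq_quotmod; rewrite reprK.
Qed.

Lemma pi_quotmodZ a v : quotmod_scale a (\pi v) = \pi_quotmod (a *: v).
Proof.
apply: quotmod_mapE => [b u w|w]; last exact: rpredZ.
by rewrite scalerDr !scalerA mulrC.
Qed.

Lemma pi_quotmodD u v : \pi_quotmod (u + v) = \pi u + \pi v :> quotmod.
Proof. exact: (Quotient.pi_add quotmod_ker). Qed.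

Fact quotmod_scaleA a b q :
  quotmod_scale a (quotmod_scale b q) = quotmod_scale (a * b) q.
Proof. by rewrite -[q]reprK !pi_quotmodZ scalerA. Qed.

Fact quotmod_scale1 : left_id 1 quotmod_scale.
Proof. by move=> q; rewrite -[q]reprK pi_quotmodZ scale1r. Qed.

Fact quotmod_scaleDr : right_distributive quotmod_scale +%R.
Proof.
move=> a p q; rewrite -[p]reprK -[q]reprK.
by rewrite -pi_quotmodD !pi_quotmodZ scalerDr pi_quotmodD.
Qed.

Fact quotmod_scaleDl q : {morph quotmod_scale^~ q : a b / a + b}.
Proof.
by move=> a b; rewrite -[q]reprK !pi_quotmodZ scalerDl pi_quotmodD.
Qed.

HB.instance Definition _ := GRing.Zmodule_isLmodule.Build F quotmod
  quotmod_scaleA quotmod_scale1 quotmod_scaleDr quotmod_scaleDl.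

Lemma pi_quotmod_linear : linear (\pi_quotmod : V -> quotmod).
Proof. by move=> a u v; rewrite pi_quotmodD -pi_quotmodZ. Qed.

End QuotientSpace.

Section FreeVectorSpace.
Variables (F : fieldType) (K : choiceType).

Lemma freegUZ (c : F) (x : K) : << c *g x >> = c *: << x >> :> {freeg K / F}.
Proof. by apply/eqP/freeg_eqP => y; rewrite coeffZ !coeffU mul1r. Qed.

Variables (P : lmodType F) (g : K -> P).

HB.instance Definition _ :=
  GRing.isZmodMorphism.Build {freeg K / F} P (fglift g) (lift_is_additive g).

Lemma fglift_linear : linear (fglift g).
Proof.
have gE D : fglift g D = \sum_(z <- dom D) coeff z D *: g z.
  rewrite -[in LHS](freeg_sumE D) raddf_sum /=.
  by apply: eq_bigr => z _; rewrite liftU.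
move=> a D E; rewrite raddfD; congr (_ + _).
rewrite -[in LHS](freeg_sumE D) scaler_sumr raddf_sum gE scaler_sumr /=.
by apply: eq_bigr => z _; rewrite freegUZ scalerA -freegUZ liftU scalerA.
Qed.

End FreeVectorSpace.

(* The tensor product over F: the free vector space on M * N modulo the span *)
(* of the bilinearity relations.                                             *)
Section TensorProduct.
Variables (F : fieldType) (M N : lmodType F).

Local Notation free := {freeg (M * N)%type / F}.

Definition bilinear_relations : set free :=
  [set r : free | exists a m m' n,
     r = << (a *: m + m', n) >> - (a *: << (m, n) >> + << (m', n) >>)] `|`
  [set r : free | exists a m n n',
     r = << (m, a *: n + n') >> - (a *: << (m, n) >> + << (m, n') >>)].

Definition tens_ker : {pred free} := in_set (span bilinear_relations).

Fact tens_ker_submod_closed : submod_closed tens_ker.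
Proof. exact: span_subspace. Qed.

HB.instance Definition _ :=
  GRing.isSubmodClosed.Build F free tens_ker tens_ker_submod_closed.

Definition tens : Type := quotmod tens_ker.

HB.instance Definition _ := EqQuotient.on tens.
HB.instance Definition _ := GRing.Lmodule.on tens.

Definition tensor (m : M) (n : N) : tens := \pi_tens << (m, n) >>.

Local Notation "m ⊗ n" := (tensor m n).

Lemma tensor_bilinear : bilinear_map tensor.
Proof.
have piL := @pi_quotmod_linear F free tens_ker.
split=> [n a m m'|m a n n'] /=; rewrite /tensor -piL; apply/eq_quotmod.
  by apply/asboolP; apply: sub_span; left; exists a, m, m', n.
by apply/asboolP; apply: sub_span; right; exists a, m, n, n'.
Qed.

(* The map out of the tensor product sending m ⊗ n to f m n. *)
Definition tens_lift (P : lmodType F) (f : M -> N -> P) (t : tens) : P :=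
  fglift (fun mn => f mn.1 mn.2) (repr t).

Section TensLift.
Variables (P : lmodType F) (f : M -> N -> P).
Hypothesis f_bil : bilinear_map f.

Let g := fglift (fun mn : M * N => f mn.1 mn.2) : free -> P.

Let gL : linear g. Proof. exact: fglift_linear. Qed.

Let gB u v : g (u - v) = g u - g v. Proof. exact: raddfB. Qed.

Let gU m n : g << (m, n) >> = f m n.
Proof. by rewrite /g liftU scale1r. Qed.

Let g_ker : span bilinear_relations `<=` [set r | g r = 0].
Proof.
apply: span_sub; first apply/subspaceP.
  split=> [|a u v /= gu gv] /=; first exact: raddf0.
  by rewrite gL gu gv scaler0 addr0.
move=> _ [] [a] [m] [m'] [n] -> /=.
  by rewrite gB gL !gU (f_bil.1 n a m m') subrr.
by rewrite gB gL !gU (f_bil.2 m a m' n) subrr.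
Qed.

Let liftE r : tens_lift f (\pi r) = g r.
Proof.
apply/eqP; rewrite -subr_eq0 -gB; apply/eqP/g_ker/asboolP.
by apply/(@eq_quotmod F free tens_ker); rewrite reprK.
Qed.

Lemma tens_liftE m n : tens_lift f (m ⊗ n) = f m n.
Proof. by rewrite liftE gU. Qed.

Lemma tens_lift_linear : linear (tens_lift f).
Proof.
move=> a s t; rewrite -[s]reprK -[t]reprK.
by rewrite -(@pi_quotmod_linear F free tens_ker) !liftE gL.
Qed.

End TensLift.

Lemma span_tensor (t : tens) : span [set m ⊗ n | m in setT & n in setT] t.
Proof.
set G := span _; have /subspaceP[G0 GL] : subspace G by exact: span_subspace.
rewrite -[t]reprK -[repr t]freeg_sumE.
have piL := @pi_quotmod_linear F free tens_ker.
elim: (dom _) => [|[m n] s IHs].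
  rewrite big_nil; suff -> : \pi_tens 0 = 0 :> tens by [].
  by have := piL (-1) 0 0; rewrite scaler0 addr0 scaleN1r addNr.
rewrite big_cons freegUZ piL; apply: GL IHs; apply: sub_span.
by exists m => //; exists n.
Qed.

(* The image of A ⊗ B in M ⊗ N, for subspaces A of M and B of N. *)
Definition tens_sub (A : set M) (B : set N) : set tens :=
  span [set a ⊗ b | a in A & b in B].

End TensorProduct.

Notation "m ⊗ n" := (tensor m n) : ring_scope.

Section TensorActions.
Variables (F : fieldType) (L : leftLeibnizType F) (M N : leibnizBimodType L).

Definition tens_lact (x : L) : tens M N -> tens M N :=
  tens_lift (fun m n => (x *> m) ⊗ n + m ⊗ (x *> n)).

Definition tens_ract (t : tens M N) (x : L) : tens M N :=
  tens_lift (fun m n => (m <* x) ⊗ n + m ⊗ (n <* x)) t.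

Section BimoduleActions.
Variable P : leibnizBimodType L.

Lemma lact_linear (x : L) : linear (lact x : P -> P).
Proof. by have [[_ ll] _ _ _ _] := @leibniz_bimoduleP _ _ P; exact: ll. Qed.

Lemma ract_linear (x : L) : linear (fun p : P => p <* x).
Proof. by have [_ [rl _] _ _ _] := @leibniz_bimoduleP _ _ P; exact: rl. Qed.

End BimoduleActions.

Lemma derivation_bilinear (f : M -> M) (g : N -> N) : linear f -> linear g ->
  bilinear_map (fun m n => f m ⊗ n + m ⊗ g n).
Proof.
move=> fL gL; have [tl tr] := tensor_bilinear M N.
split=> [n a m m'|m a n n'] /=.
  by rewrite fL (tl n) (tl (g n)) scalerDr addrACA.
by rewrite gL (tr m) (tr (f m)) scalerDr addrACA.
Qed.

Lemma tens_lactE x m n : tens_lact x (m ⊗ n) = (x *> m) ⊗ n + m ⊗ (x *> n).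
Proof. exact/tens_liftE/derivation_bilinear/lact_linear/lact_linear. Qed.

Lemma tens_ractE x m n : tens_ract (m ⊗ n) x = (m <* x) ⊗ n + m ⊗ (n <* x).
Proof. exact/tens_liftE/derivation_bilinear/ract_linear/ract_linear. Qed.

Lemma tens_lact_linear x : linear (tens_lact x).
Proof. exact/tens_lift_linear/derivation_bilinear/lact_linear/lact_linear. Qed.

Lemma tens_ract_linear x : linear (tens_ract^~ x).
Proof. exact/tens_lift_linear/derivation_bilinear/ract_linear/ract_linear. Qed.

Definition action_stable (W : set (tens M N)) : Prop :=
  forall x t, W t -> W (tens_lact x t) /\ W (tens_ract t x).

Definition bimod0 (P : leibnizBimodType L) : set P :=
  span [set x *> m + m <* x | x in [set: L] & m in [set: P]].

Definition bimodL (P : leibnizBimodType L) : set P :=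
  span [set m <* x | m in [set: P] & x in [set: L]].

Definition trunc_gens : set (tens M N) :=
  [set t | exists x y m n,
     t = (x *> m + m <* x) ⊗ (n <* y) + (m <* y) ⊗ (x *> n + n <* x)].

Definition trunc_set : set (tens M N) :=
  smallest (fun W => subspace W /\ action_stable W) trunc_gens.

Definition trunc0_set : set (tens M N) :=
  [set u + v | u in tens_sub (@bimod0 M) (@bimodL N)
             & v in tens_sub (@bimodL M) (@bimod0 N)].

(* T(M, N) and T_0(M, N) as boolean predicates, the form [quotmod] expects. *)
Definition trunc : {pred tens M N} := in_set trunc_set.
Definition trunc0 : {pred tens M N} := in_set trunc0_set.

Fact trunc_submod_closed : submod_closed trunc.
Proof. by apply: smallest_subspace => W []. Qed.

Fact trunc0_submod_closed : submod_closed trunc0.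
Proof.
have /subspaceP[A0 AL] := span_subspace [set a ⊗ b | a in @bimod0 M & b in @bimodL N].
have /subspaceP[B0 BL] := span_subspace [set a ⊗ b | a in @bimodL M & b in @bimod0 N].
apply/subspaceP; split; first by exists 0 => //; exists 0; rewrite ?addr0.
move=> c _ _ [u Au [v Bv <-]] [u' Au' [v' Bv' <-]].
exists (c *: u + u'); first exact: AL.
by exists (c *: v + v'); [exact: BL | rewrite scalerDr addrACA].
Qed.

HB.instance Definition _ :=
  GRing.isSubmodClosed.Build F (tens M N) trunc trunc_submod_closed.
HB.instance Definition _ :=
  GRing.isSubmodClosed.Build F (tens M N) trunc0 trunc0_submod_closed.

Lemma trunc_stable : action_stable trunc_set.
Proof.
by move=> x t Tt; split=> W WG; have [_ /(_ x t (Tt W WG)) []] := WG.1.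
Qed.

Lemma bimod_lact_ract0 (P : leibnizBimodType L) x y (p : P) :
  (x *> p + p <* x) <* y = 0.
Proof.
have [_ _ _ lml mll] := @leibniz_bimoduleP _ _ P.
have rD u v : (u + v) <* y = u <* y + v <* y :> P.
  by have := @ract_linear P y 1 u v; rewrite !scale1r.
by rewrite rD lml mll addrA subrK subrr.
Qed.

Lemma span_stable (V : lmodType F) (f : V -> V) (G : set V) :
  linear f -> (forall v, G v -> span G (f v)) -> stable f (span G).
Proof.
move=> fL fG; have /subspaceP[G0 GL] := span_subspace G.
apply: span_sub; last exact: fG.
apply/subspaceP; split=> [|a u v Gu Gv] /=; last by rewrite fL; exact: GL.
suff -> : f 0 = 0 by [].
by have := fL (-1) 0 0; rewrite scaler0 addr0 scaleN1r addNr.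
Qed.

Lemma bimod0_stable (P : leibnizBimodType L) x :
  stable (lact x) (@bimod0 P) /\ stable (fun p : P => p <* x) (@bimod0 P).
Proof.
have /subspaceP[S0 SL] := span_subspace
  [set y *> p + p <* y | y in [set: L] & p in [set: P]].
have SG y (p : P) : bimod0 (y *> p + p <* y).
  by apply: sub_span; exists y => //; exists p.
split; apply: span_stable; try exact: lact_linear; try exact: ract_linear.
  move=> _ [y _ [p _ <-]]; set q := y *> p + p <* y.
  have := SG x q; rewrite bimod_lact_ract0 addr0; exact.
by move=> _ [y _ [p _ <-]]; rewrite bimod_lact_ract0.
Qed.

Lemma bimodL_stable (P : leibnizBimodType L) x :
  stable (lact x) (@bimodL P) /\ stable (fun p : P => p <* x) (@bimodL P).
Proof.
have [_ _ _ lml _] := @leibniz_bimoduleP _ _ P.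
have /subspaceP[S0 SL] := span_subspace
  [set p <* y | p in [set: P] & y in [set: L]].
have SG (p : P) y : bimodL (p <* y) by apply: sub_span; exists p => //; exists y.
split; apply: span_stable; try exact: lact_linear; try exact: ract_linear.
  move=> _ [p _ [y _ <-]].
  have -> : x *> (p <* y) = 1 *: ((x *> p) <* y) + p <* (x ∙ y) :> P.
    by rewrite lml scale1r subrK.
  by apply: SL; exact: SG.
by move=> _ [p _ [y _ <-]]; exact: SG.
Qed.

Lemma tens_sub_stable (A : set M) (B : set N) x :
  stable (lact x) A /\ stable (fun p : M => p <* x) A ->
  stable (lact x) B /\ stable (fun p : N => p <* x) B ->
  stable (tens_lact x) (tens_sub A B) /\ stable (tens_ract^~ x) (tens_sub A B).
Proof.
move=> [Al Ar] [Bl Br]; have /subspaceP[S0 SL] := span_subspace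
  [set a ⊗ b | a in A & b in B].
have SG a b : A a -> B b -> tens_sub A B (a ⊗ b).
  by move=> Aa Bb; apply: sub_span; exists a => //; exists b.
have SD u v : tens_sub A B u -> tens_sub A B v -> tens_sub A B (u + v).
  by move=> Su Sv; rewrite -[u]scale1r; exact: SL.
split; apply: span_stable; try exact: tens_lact_linear;
  try exact: tens_ract_linear; move=> _ [a Aa [b Bb <-]].
  by rewrite tens_lactE; apply: SD; apply: SG => //; [apply: Al|apply: Bl].
by rewrite tens_ractE; apply: SD; apply: SG => //; [apply: Ar|apply: Br].
Qed.

Lemma trunc0_stable : action_stable trunc0_set.
Proof.
move=> x _ [u Au [v Bv <-]].
have [Al Ar] := tens_sub_stable (@bimod0_stable M x) (@bimodL_stable N x).
have [Bl Br] := tens_sub_stable (@bimodL_stable M x) (@bimod0_stable N x).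
have lD s t : tens_lact x (s + t) = tens_lact x s + tens_lact x t.
  by have := tens_lact_linear x 1 s t; rewrite !scale1r.
have rD s t : tens_ract (s + t) x = tens_ract s x + tens_ract t x.
  by have := tens_ract_linear x 1 s t; rewrite !scale1r.
rewrite lD rD; split.
  by exists (tens_lact x u); [exact: Al|exists (tens_lact x v); [exact: Bl|]].
by exists (tens_ract u x); [exact: Ar|exists (tens_ract v x); [exact: Br|]].
Qed.

Section QuotientActions.
Variable W : submodClosed (tens M N).

Definition quot_lact (x : L) : quotmod W -> quotmod W :=
  quotmod_map (tens_lact x).

Definition quot_ract (q : quotmod W) (x : L) : quotmod W :=
  quotmod_map (tens_ract^~ x) q.

End QuotientActions.

Definition tens_over : lmodType F := quotmod trunc.
Definition tens_under : lmodType F := quotmod trunc0.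

Definition over_lact : L -> tens_over -> tens_over := @quot_lact trunc.
Definition over_ract : tens_over -> L -> tens_over := @quot_ract trunc.
Definition under_lact : L -> tens_under -> tens_under := @quot_lact trunc0.
Definition under_ract : tens_under -> L -> tens_under := @quot_ract trunc0.

Lemma quot_actE (W : set (tens M N)) (Wc : submodClosed (tens M N)) :
  (Wc : {pred tens M N}) = in_set W -> action_stable W ->
  forall x t,
    quot_lact x (\pi t) = \pi_(quotmod Wc) (tens_lact x t) /\
    quot_ract (\pi t) x = \pi_(quotmod Wc) (tens_ract t x).
Proof.
move=> WcE Wst x t.
have inWc w : (w \in Wc) = `[< W w >] by rewrite -topredE /= WcE.
split; apply: quotmod_mapE.
- exact: tens_lact_linear.
- move=> w; rewrite !inWc => /asboolP Ww; apply/asboolP.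
  by have [] := Wst x w Ww.
- exact: tens_ract_linear.
- move=> w; rewrite !inWc => /asboolP Ww; apply/asboolP.
  by have [] := Wst x w Ww.
Qed.

Lemma over_actE x t :
  over_lact x (\pi t) = \pi_(quotmod trunc) (tens_lact x t) /\
  over_ract (\pi t) x = \pi_(quotmod trunc) (tens_ract t x).
Proof. exact: (@quot_actE trunc_set trunc erefl trunc_stable). Qed.

Lemma under_actE x t :
  under_lact x (\pi t) = \pi_(quotmod trunc0) (tens_lact x t) /\
  under_ract (\pi t) x = \pi_(quotmod trunc0) (tens_ract t x).
Proof. exact: (@quot_actE trunc0_set trunc0 erefl trunc0_stable). Qed.

End TensorActions.

Arguments tens_over {F L} M N.
Arguments tens_under {F L} M N.

(* Main.v *)
Require Import Defs.
From HB Require Import structures.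
From mathcomp Require Import all_boot all_algebra.
From mathcomp Require Import boolp classical_sets.

(* The derivation actions on M ⊗ N satisfy (LLM) and (LML) exactly, while the *)
(* defect (t·x)·y - (t·(xy) - x·(t·y)) of (MLL) at t = m ⊗ n is precisely the *)
(* generator (x·m + m·x) ⊗ (n·y) + (m·y) ⊗ (x·n + n·x) of T(M, N). Hence the  *)
(* quotient by any stable subspace containing S(M, N) is a bimodule; both     *)
(* T(M, N) and T_0(M, N) are such subspaces.                                  *)

Set Implicit Arguments.
Unset Strict Implicit.
Unset Printing Implicit Defensive.

Import GRing.Theory.
Local Open Scope classical_set_scope.
Local Open Scope ring_scope.
Local Open Scope quotient_scope.

(** All three identities are linear in the tensor, so [tens_ind] reduces them to [m ⊗ n]. There the
    terms acting twice on one factor satisfy the axioms of [M] or [N], so only mixed terms such as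
    [(x *> m) ⊗ (n <* y)] matter: they cancel in (LLM), match in (LML), and in (MLL) add up to a
    generator of T(M, N) ([tens_MLL_defect]). [quot_bimodule] passes to the quotient; it applies to
    T_0(M, N) by [trunc_gens_sub0]. *)

Section Tensors.
Variables (F : fieldType) (M N : lmodType F).

Lemma tens_ind (P : tens M N -> Prop) :
  (forall m n, P (m ⊗ n)) ->
  (forall a u v, P u -> P v -> P (a *: u + v)) -> forall t, P t.
Proof.
move=> Pt PL t; move: t (span_tensor t).
apply: Defs.span_sub => [|_ [m _ [n _ <-]]]; last exact: Pt.
apply/subspaceP; split; last exact: PL.
(* The zero case needs no separate premise: 0 is [- (0 ⊗ 0) + 0 ⊗ 0]. *)
by have := PL (-1) _ _ (Pt 0 0) (Pt 0 0); rewrite scaleN1r addNr.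
Qed.

Lemma tensorDl (m m' : M) (n : N) : (m + m') ⊗ n = m ⊗ n + m' ⊗ n.
Proof. by have /= := (tensor_bilinear M N).1 n 1 m m'; rewrite !scale1r. Qed.

Lemma tensorDr (m : M) (n n' : N) : m ⊗ (n + n') = m ⊗ n + m ⊗ n'.
Proof. by have /= := (tensor_bilinear M N).2 m 1 n n'; rewrite !scale1r. Qed.

Lemma tensorBl (m m' : M) (n : N) : (m - m') ⊗ n = m ⊗ n - m' ⊗ n.
Proof.
rewrite [m - m']addrC [RHS]addrC -!scaleN1r.
exact: (tensor_bilinear M N).1.
Qed.

Lemma tensorBr (m : M) (n n' : N) : m ⊗ (n - n') = m ⊗ n - m ⊗ n'.
Proof.
rewrite [n - n']addrC [RHS]addrC -!scaleN1r.
exact: (tensor_bilinear M N).2.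
Qed.

End Tensors.

Section TensorActions.
Variables (F : fieldType) (L : leftLeibnizType F) (M N : leibnizBimodType L).
Implicit Types (x y : L) (t u v : tens M N).

Lemma tens_lactD x u v : tens_lact x (u + v) = tens_lact x u + tens_lact x v.
Proof. by have := tens_lact_linear x 1 u v; rewrite !scale1r. Qed.

Lemma tens_ractD x u v : tens_ract (u + v) x = tens_ract u x + tens_ract v x.
Proof. by have := tens_ract_linear x 1 u v; rewrite !scale1r. Qed.

(** The lift only provides linearity in the tensor; linearity in the algebra element comes from the
    actions on [M] and [N]. *)
Lemma tens_lact_linearl t : linear ((@tens_lact F L M N)^~ t).
Proof.
move=> a x y; elim/tens_ind: t => [m n|b u v IHu IHv].
  have [[Ml _] _ _ _ _] := @leibniz_bimoduleP _ _ M.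
  have [[Nl _] _ _ _ _] := @leibniz_bimoduleP _ _ N.
  rewrite !tens_lactE (Ml m) (Nl n) /= ((tensor_bilinear M N).1 n).
  by rewrite ((tensor_bilinear M N).2 m) scalerDr addrACA.
rewrite !tens_lact_linear /= IHu IHv !scalerDr !scalerA [b * a]mulrC.
by rewrite addrACA.
Qed.

Lemma tens_ract_linearr t : linear (tens_ract t).
Proof.
move=> a x y; elim/tens_ind: t => [m n|b u v IHu IHv].
  have [_ [_ Mr] _ _ _] := @leibniz_bimoduleP _ _ M.
  have [_ [_ Nr] _ _ _] := @leibniz_bimoduleP _ _ N.
  rewrite !tens_ractE (Mr m) (Nr n) /= ((tensor_bilinear M N).1 n).
  by rewrite ((tensor_bilinear M N).2 m) scalerDr addrACA.
rewrite !tens_ract_linear /= IHu IHv !scalerDr !scalerA [b * a]mulrC.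
by rewrite addrACA.
Qed.

Lemma tens_LLM x y t :
  tens_lact (x ∙ y) t =
  tens_lact x (tens_lact y t) - tens_lact y (tens_lact x t).
Proof.
elim/tens_ind: t => [m n|b u v IHu IHv].
  have [_ _ Ml _ _] := @leibniz_bimoduleP _ _ M.
  have [_ _ Nl _ _] := @leibniz_bimoduleP _ _ N.
  rewrite !tens_lactE !tens_lactD !tens_lactE Ml Nl tensorBl tensorBr.
  (* The last two pairs are the mixed terms, symmetric in [x] and [y], which cancel in the
     commutator. *)
  rewrite !opprD [RHS](AC ((2*2)*(2*2)) ((1*5)*(4*8)*(2*7)*(3*6))) /=.
  by rewrite !subrr !addr0.
rewrite !tens_lact_linear IHu IHv scalerBr opprD.
by rewrite addrACA.
Qed.

Lemma tens_LML x y t :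
  tens_ract (tens_lact x t) y =
  tens_lact x (tens_ract t y) - tens_ract t (x ∙ y).
Proof.
elim/tens_ind: t => [m n|b u v IHu IHv].
  have [_ _ _ Ml _] := @leibniz_bimoduleP _ _ M.
  have [_ _ _ Nl _] := @leibniz_bimoduleP _ _ N.
  rewrite !(tens_lactE, tens_ractE, tens_lactD, tens_ractD) Ml Nl.
  by rewrite tensorBl tensorBr opprD [RHS](AC ((2*2)*2) (((1*5)*3)*(2*(4*6)))).
rewrite !(tens_lact_linear, tens_ract_linear) /= IHu IHv scalerBr opprD.
by rewrite addrACA.
Qed.

Lemma tens_MLL_defect x y (m : M) (n : N) :
  tens_ract (tens_ract (m ⊗ n) x) y -
    (tens_ract (m ⊗ n) (x ∙ y) - tens_lact x (tens_ract (m ⊗ n) y)) =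
  (x *> m + m <* x) ⊗ (n <* y) + (m <* y) ⊗ (x *> n + n <* x).
Proof.
have [_ _ _ _ Mr] := @leibniz_bimoduleP _ _ M.
have [_ _ _ _ Nr] := @leibniz_bimoduleP _ _ N.
rewrite !(tens_lactE, tens_ractE, tens_lactD, tens_ractD) Mr Nr.
rewrite tensorBl tensorBr tensorDl tensorDr opprB opprD.
(* The first two pairs are the four mixed terms, which form the generator; the other four pairs
   cancel. *)
rewrite [LHS](AC ((3*(1*2))*((2*2)*2))
  ((9*3)*(8*4)*(1*11)*(7*2)*(5*12)*(10*6))) /=.
by rewrite !subrr !addr0.
Qed.

Lemma quot_bimodule (W : set (tens M N)) (Wc : submodClosed (tens M N)) :
  (Wc : {pred tens M N}) = in_set W -> action_stable W ->
  @trunc_gens F L M N `<=` W ->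
  leibniz_bimodule_axioms (@quot_lact F L M N Wc) (@quot_ract F L M N Wc).
Proof.
move=> WcE Wst WG.
have lE x t : quot_lact x (\pi t) = \pi_(quotmod Wc) (tens_lact x t).
  exact: (quot_actE WcE Wst x t).1.
have rE x t : quot_ract (\pi t) x = \pi_(quotmod Wc) (tens_ract t x).
  exact: (quot_actE WcE Wst x t).2.
have piL := @pi_quotmod_linear F _ Wc.
have piB u v : \pi_(quotmod Wc) (u - v) = \pi u - \pi v.
  by rewrite addrC -scaleN1r piL scaleN1r addrC.
split; first split.
- by move=> q a x y /=; rewrite -[q]reprK !lE tens_lact_linearl piL.
- move=> x a p q /=.
  by rewrite -[p]reprK -[q]reprK -piL !lE tens_lact_linear piL.
- split.
  + move=> x a p q /=.
    by rewrite -[p]reprK -[q]reprK -piL !rE (tens_ract_linear x) piL.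
  + by move=> q a x y /=; rewrite -[q]reprK !rE tens_ract_linearr piL.
- by move=> x y q; rewrite -[q]reprK !(lE _ (repr q)) !lE tens_LLM piB.
- move=> x y q; rewrite -[q]reprK !(lE _ (repr q), rE _ (repr q)) !(lE, rE).
  by rewrite tens_LML piB.
- move=> x y q; rewrite -[q]reprK !(lE _ (repr q), rE _ (repr q)) !(lE, rE) -piB.
  (* Unlike the other axioms, (MLL) holds only after projection, so the induction runs on the
     equality of classes. *)
  elim/tens_ind: (repr q) => [m n|a u v IHu IHv].
    apply/eq_quotmod; rewrite tens_MLL_defect -topredE /= WcE.
    by apply/asboolP/WG; exists x, y, m, n.
  rewrite !(tens_lact_linear, tens_ract_linear) /= piL IHu IHv -piL.
  by rewrite scalerBr addrACA opprD.
Qed.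

(** The two summands of a generator lie in M_0 ⊗ NL and ML ⊗ N_0 respectively. *)
Lemma trunc_gens_sub0 : @trunc_gens F L M N `<=` @trunc0_set F L M N.
Proof.
move=> _ [x [y [m [n ->]]]].
have S0 (P : leibnizBimodType L) (p : P) : bimod0 (x *> p + p <* x).
  by apply: Defs.sub_span; exists x => //; exists p.
have SL (P : leibnizBimodType L) (p : P) : bimodL (p <* y).
  by apply: Defs.sub_span; exists p => //; exists y.
exists ((x *> m + m <* x) ⊗ (n <* y)).
  by apply: Defs.sub_span; exists (x *> m + m <* x) => //; exists (n <* y).
exists ((m <* y) ⊗ (x *> n + n <* x)) => //.
by apply: Defs.sub_span; exists (m <* y) => //; exists (x *> n + n <* x).
Qed.

End TensorActions.

Theorem proposition4p2 (F : fieldType) (L : leftLeibnizType F)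
    (M N : leibnizBimodType L) :
  leibniz_bimodule_axioms (@over_lact F L M N) (@over_ract F L M N) /\
  leibniz_bimodule_axioms (@under_lact F L M N) (@under_ract F L M N).
Proof.
split.
  apply: (@quot_bimodule F L M N (@trunc_set F L M N)) => //.
    exact: trunc_stable.
  exact: sub_gen_smallest.
apply: (@quot_bimodule F L M N (@trunc0_set F L M N)) => //.
  exact: trunc0_stable.
exact: trunc_gens_sub0.
Qed.
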